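(* Let $n,k,r,t$ be positive integers such that $r\leq t\leq k+r-2$ and $n\geq 4k(t-r+2)(er)^{t-r+2}$. Let $\mathcal{F}_1,\mathcal{F}_2,\dots,\mathcal{F}_k$ be $r$-graphs on a common vertex set $V$ with $|V|=n$. Suppose that for every $i\in\{1,\dots,k\}$ there exists some $s\in\{r,r+1,\dots,t\}$ such that $K_s^r(\mathcal{F}_i)>K_s^r(\mathcal{F}^{(r)}_{n,k-1,1})$. Then there exist pairwise disjoint edges $F_1\in\mathcal{F}_1,\dots,F_k\in\mathcal{F}_k$.
   Context: An $r$-graph is a pair $(V,E)$ with $V$ a finite set and $E\subseteq\binom{V}{r}$; edges are identified with the hypergraph. For $s\geq r$, an $s$-clique of an $r$-graph $\mathcal{H}$ is a set of $s$ vertices every $r$-subset of which is an edge; $K_s^r(\mathcal{H})$ denotes the number of $s$-cliques of $\mathcal{H}$. $[m]=\{1,\dots,m\}$. For positive integers $n,k,r$, $\mathcal{F}^{(r)}_{n,k,1}$ is the $r$-graph on $[n]$ whose edges are all $F\in\binom{[n]}{r}$ with $F\cap[k]\neq\emptyset$. Here $e$ is Euler's number. *)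

(* Defs.v *)
From mathcomp Require Import all_boot all_order all_algebra.
From mathcomp Require Import reals sequences exp.
Set Implicit Arguments.
Unset Strict Implicit.
Unset Printing Implicit Defensive.

Section Hypergraphs.
Variable V : finType.

Definition rsets (r : nat) : {set {set V}} := [set A : {set V} | #|A| == r].

Definition is_rgraph (r : nat) (H : {set {set V}}) : bool := H \subset rsets r.

Definition is_clique (r s : nat) (H : {set {set V}}) (S : {set V}) : bool :=
  (#|S| == s) && [forall A in rsets r, (A \subset S) ==> (A \in H)].

Definition num_cliques (r s : nat) (H : {set {set V}}) : nat :=
  #|[set S : {set V} | is_clique r s H S]|.

End Hypergraphs.

(* F^(r)_{n,k,1}, with [n] = {1, ..., n} encoded as 'I_n: the ordinal i stands
   for i + 1, so that [k] is the set of ordinals i < k. *)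
Definition Fnk1 (r n k : nat) : {set {set 'I_n}} :=
  [set A in rsets 'I_n r | A :&: [set i : 'I_n | i < k] != set0].

(* Main.v *)
Require Import Defs.
From mathcomp Require Import all_boot all_order all_algebra.
From mathcomp Require Import reals sequences exp.
From mathcomp Require Import fingroup perm zify ring lra.

(** By induction on [#|J|], any subfamily [J] has a rainbow matching avoiding any
    set [Z] with [#|J| + #|Z| <= k].  Write [Q = #|J| - 1], let [d] be the maximal
    codegree of two vertices, and measure degrees in [F_i] outside [Z].  A vertex
    of degree more than [r Q d] in some [F_i] can be put into [Z], since it extends
    any rainbow matching of the other families.  If every [F_i] has more than [Q]
    vertices of degree exceeding [2 Q d], choose distinct ones; their links are
    dense enough for a rainbow matching by a mixed-uniformity version of a lemma of
    Huang, Loh and Sudakov, proved by shifting.  Otherwise some [F_i] has only [Q]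
    such vertices, while its edges outside [Z] all meet the at most [r Q] vertices
    of a rainbow matching of the other families; so there are at most
    [3 r Q ^ 2 d] of them.  Every clique of [F_i] with at least [r] vertices
    outside [Z] consists of one of these edges and [s - r] vertices of that cover,
    which leaves too few cliques. *)

Set Implicit Arguments.
Unset Strict Implicit.
Unset Printing Implicit Defensive.
Import Order.TTheory GRing.Theory Num.Theory.

Definition rainbow (V I : finType) (J : {set I}) (F : I -> {set {set V}}) : Prop :=
  exists G : I -> {set V},
    {in J, forall i, G i \in F i} /\
    {in J &, forall i j, i != j -> [disjoint G i & G j]}.

Lemma rainbow0 (V I : finType) (F : I -> {set {set V}}) : rainbow set0 F.
Proof. by exists (fun=> set0); split=> i; rewrite inE. Qed.

Definition avoid (V I : finType) (Z : {set V}) (F : I -> {set {set V}}) i :=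
  [set A in F i | [disjoint A & Z]].

Lemma rainbow_extend (V I : finType) (J : {set I}) (F : I -> {set {set V}}) i A :
  i \in J -> A \in F i -> rainbow (J :\ i) (avoid A F) -> rainbow J F.
Proof.
move=> iJ AF [G [GF Gdis]].
exists (fun j => if j == i then A else G j); split=> [j jJ|j l jJ lJ jl].
  case: eqP => [-> //|/eqP ji].
  by have := GF j; rewrite !inE ji jJ => /(_ isT)/andP[].
case: eqP => [ji|/eqP ji]; case: eqP => [li|/eqP li].
- by rewrite ji li eqxx in jl.
- have := GF l; rewrite !inE li lJ => /(_ isT)/andP[_].
  by rewrite disjoint_sym.
- by have := GF j; rewrite !inE ji jJ => /(_ isT)/andP[_].
- by apply: Gdis; rewrite // !inE ?ji ?li.
Qed.

(** * Rainbow matchings in dense families *)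

Section UnionBound.
Local Open Scope ring_scope.
Variables V I : finType.

Lemma sum_card_disjoint (U : {set V}) (r p : nat) (H : {set {set V}}) :
  {in H, forall B : {set V}, (B \subset U) && (#|B| == p)} ->
  (\sum_(A : {set V} | (A \subset U) && (#|A| == r)) #|[set B in H | [disjoint B & A]]|
    = #|H| * 'C(#|U| - p, r))%N.
Proof.
move=> HU.
under eq_bigr => A _ do rewrite -sum1dep_card.
rewrite (exchange_big_dep (mem H)) /=; last by move=> A B _ /andP[].
rewrite -sum_nat_const; apply: eq_bigr => B BH.
have /andP[BU /eqP cB] := HU B BH.
rewrite sum1dep_card -cB -(cardsDS BU) -cards_draws.
apply: eq_card => A; rewrite !inE BH /= subsetD (disjoint_sym B).
by rewrite andbAC.
Qed.

(** Place disjoint sets of sizes [r i] in [U] at random: the one for [i] misses [F i] with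
    probability [1 - #|F i| / 'C(#|U|, r i)], so if these sum to less than 1 some placement misses
    nothing. The induction fixes one set at a time, keeping the conditional expectation below 1. *)
Lemma rainbow_union_bound (J : {set I}) (U : {set V}) (r : I -> nat)
    (F : I -> {set {set V}}) :
  {in J, forall i (A : {set V}), A \in F i -> (A \subset U) && (#|A| == r i)} ->
  (\sum_(i in J) r i <= #|U|)%N ->
  \sum_(i in J) (1 - #|F i|%:R / 'C(#|U|, r i)%:R) < 1 :> rat ->
  rainbow J F.
Proof.
move: {2}#|J| (erefl #|J|) => m.
elim: m J U F => [|m IH] J U F.
  by move/cards0_eq-> => _ _ _; exact: rainbow0.
move=> cJ FU rU Flt.
have [j jJ] : exists j, j \in J by apply/set0Pn; rewrite -card_gt0 cJ.
set J' := J :\ j.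
have cJ' : #|J'| = m by move: cJ; rewrite (cardsD1 j) jJ => -[].
have J'J i : i \in J' -> i \in J by rewrite inE => /andP[].
have rU' : (r j + \sum_(i in J') r i <= #|U|)%N.
  by move: rU; rewrite (big_setD1 j jJ).
have rjU : (r j <= #|U|)%N by apply: leq_trans rU'; exact: leq_addr.
pose D := [pred A : {set V} | (A \subset U) && (#|A| == r j)].
have cD : #|D| = 'C(#|U|, r j).
  by rewrite -cards_draws; apply: eq_card => A; rewrite !inE.
have FD : F j \subset D by apply/subsetP=> A /(FU j jJ).
(* Probability that a random [r i]-subset of [U :\: A] is not in [F i], once [A] is chosen for
   [j]. *)
pose g (A : {set V}) i : rat := 1 - #|avoid A F i|%:R / 'C(#|U| - r j, r i)%:R.
have avoidU i A B : A \in D -> i \in J' -> B \in avoid A F i ->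
    (B \subset U :\: A) && (#|B| == r i).
  move=> _ iJ'; rewrite inE => /andP[BF dBA].
  by have /andP[BU ->] := FU i (J'J _ iJ') B BF; rewrite subsetD BU dBA.
have cUA A : A \in D -> #|U :\: A| = (#|U| - r j)%N.
  by move=> /andP[AU /eqP <-]; rewrite cardsDS.
have g_ge0 A i : A \in D -> i \in J' -> 0 <= g A i.
  move=> AD iJ'; rewrite subr_ge0.
  have le : (#|avoid A F i| <= 'C(#|U| - r j, r i))%N.
    rewrite -(cUA A AD) -cards_draws; apply: subset_leq_card.
    by apply/subsetP=> B /(avoidU _ _ _ AD iJ'); rewrite inE.
  have [->|C0] := posnP 'C(#|U| - r j, r i); first by rewrite invr0 mulr0 ler01.
  by rewrite ler_pdivrMr ?ltr0n // mul1r ler_nat.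
(* Averaging over [D]: if every [A] gave at least 1, the original total would be at least 1. *)
have [A AD Alt] : exists2 A, A \in D & (A \notin F j)%:R + \sum_(i in J') g A i < 1.
  case: (pickP [pred A | (A \in D) && ((A \notin F j)%:R + \sum_(i in J') g A i < 1)]).
    by move=> A /andP[AD Alt]; exists A.
  move=> none; exfalso.
  have : \sum_(A in D) (1 : rat) <=
         \sum_(A in D) ((A \notin F j)%:R + \sum_(i in J') g A i).
    apply: ler_sum => A AD; have := none A.
    by rewrite /= AD /= => /negbT; rewrite -leNgt.
  rewrite sumr_const cD big_split /= exchange_big /=.
  have -> : \sum_(A in D) (A \notin F j)%:R = 'C(#|U|, r j)%:R - #|F j|%:R :> rat.
    rewrite -natr_sum -big_mkcondr sum1_card.
    rewrite -cD -natrB; last exact: subset_leq_card.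
    congr (_ %:R); rewrite -(cardID (mem (F j)) D).
    have -> : #|[predI D & mem (F j)]| = #|F j|.
      apply: eq_card => A; rewrite !inE.
      by apply/andP/idP => [[]//|AF]; split=> //; apply: (FU j jJ).
    rewrite addKn; apply: eq_card => A; rewrite !inE; exact: andbC.
  rewrite (eq_bigr (fun i => 'C(#|U|, r j)%:R * (1 - #|F i|%:R / 'C(#|U|, r i)%:R)));
    last first.
    move=> i iJ'; rewrite sumrB sumr_const cD -mulr_suml -natr_sum.
    rewrite (eq_bigl (fun A : {set V} => (A \subset U) && (#|A| == r j))) //.
    rewrite (@sum_card_disjoint U (r j) (r i) (F i)); last by apply: FU; exact: J'J.
    rewrite mulrBr mulr1; congr (_ - _).
    have leij : (r j + r i <= #|U|)%N.
      by apply: leq_trans rU'; rewrite (big_setD1 i iJ') /= addnA leq_addr.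
    have C1 : ('C(#|U| - r j, r i)%:R != 0 :> rat).
      by rewrite pnatr_eq0 -lt0n bin_gt0; lia.
    have C2 : ('C(#|U|, r i)%:R != 0 :> rat).
      by rewrite pnatr_eq0 -lt0n bin_gt0; lia.
    (* Ordered pairs of disjoint sets of sizes [r i] and [r j], counted from either end; hence the
       average of [g A i] over [A] is the original term for [i]. *)
    have E : ('C(#|U|, r i) * 'C(#|U| - r i, r j) = 'C(#|U|, r j) * 'C(#|U| - r j, r i))%N.
      have f0 x : (0 < x`!)%N := fact_gt0 x.
      apply/eqP; rewrite -(eqn_pmul2r (f0 (r i))) -(eqn_pmul2r (f0 (r j))).
      rewrite -(eqn_pmul2r (f0 (#|U| - r i - r j)%N)); apply/eqP.
      have h1 := @bin_fact #|U| (r i) ltac:(lia).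
      have h2 := @bin_fact #|U| (r j) ltac:(lia).
      have h3 := @bin_fact (#|U| - r i)%N (r j) ltac:(lia).
      have h4 := @bin_fact (#|U| - r j)%N (r i) ltac:(lia).
      rewrite (subnAC _ (r j)) in h4.
      transitivity ('C(#|U|, r i) * (r i)`! *
        ('C(#|U| - r i, r j) * ((r j)`! * (#|U| - r i - r j)`!)))%N; first by ring.
      rewrite h3 -mulnA h1 -h2 -h4; by ring.
    move/(congr1 (fun x => x%:R : rat)): E; rewrite !natrM => E.
    apply: (mulIf C1); apply: (mulIf C2); rewrite divfK //.
    transitivity (#|F i|%:R * ('C(#|U|, r i)%:R * 'C(#|U| - r i, r j)%:R) : rat); first by ring.
    rewrite E.
    by field.
  rewrite -mulr_sumr => le.
  move: Flt; rewrite (big_setD1 j jJ) /=.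
  have Cp : 0 < 'C(#|U|, r j)%:R :> rat by rewrite ltr0n bin_gt0.
  rewrite -(ltr_pM2l Cp) mulr1 mulrDr mulrBr mulr1 [_ * (_ / _)]mulrC.
  rewrite divfK; last by rewrite gt_eqF.
  by rewrite ltNge le.
have sum_ge0 : 0 <= \sum_(i in J') g A i by apply: sumr_ge0 => i; exact: g_ge0.
have AF : A \in F j.
  by apply/negPn/negP => AF; move: Alt; rewrite AF gtrDl ltNge sum_ge0.
apply: (rainbow_extend jJ AF); apply: (IH J' (U :\: A)) => //.
- by move=> i iJ' B; exact: avoidU.
- by rewrite cUA //; lia.
- rewrite cUA //; apply: le_lt_trans Alt.
  by rewrite lerDr ler0n.
Qed.
End UnionBound.

Lemma disjoint_setU1 (V : finType) (x : V) (A B : {set V}) :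
  [disjoint x |: A & B] = (x \notin B) && [disjoint A & B].
Proof. by rewrite !disjoints_subset subUset sub1set inE. Qed.

(** * Compressions: sizes, degrees and rainbow matchings *)

Section Shift.
Variable V : finType.
Implicit Types (u w : V) (A B U : {set V}) (H : {set {set V}}).

Definition swap u w A : {set V} := tperm u w @: A.

Lemma in_swap u w A x : (x \in swap u w A) = (tperm u w x \in A).
Proof. by rewrite -{1}(tpermK u w x) mem_imset //; exact: perm_inj. Qed.

Lemma swapK u w : involutive (swap u w).
Proof. by move=> A; apply/setP=> x; rewrite !in_swap tpermK. Qed.

Lemma in_imset_swap u w H A : (A \in swap u w @: H) = (swap u w A \in H).
Proof. by rewrite -{1}(swapK u w A) mem_imset //; exact: (can_inj (swapK u w)). Qed.

Lemma card_swap u w A : #|swap u w A| = #|A|.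
Proof. by rewrite card_imset //; exact: perm_inj. Qed.

Lemma swap_id u w A : (u \in A) = (w \in A) -> swap u w A = A.
Proof.
by move=> uwA; apply/setP=> x; rewrite in_swap; case: tpermP => [->|->|].
Qed.

Lemma swap_disjoint u w A B :
  [disjoint A & B] -> [disjoint swap u w A & swap u w B].
Proof.
move=> dAB; rewrite -setI_eq0; apply/eqP/setP=> x; rewrite !inE !in_swap.
by apply/negbTE/negP => /andP[xA]; rewrite (disjointFr dAB xA).
Qed.

Lemma swap_subset u w A U :
  u \in U -> w \in U -> A \subset U -> swap u w A \subset U.
Proof.
move=> uU wU /subsetP AU; apply/subsetP=> x; rewrite in_swap.
by case: tpermP => [->|->|_ _ /AU].
Qed.

(* The compression replacing [w] by [u] in every member of [H] for which this
   does not create a set already in [H], described by its membership predicate. *)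
Definition shift u w H : {set {set V}} :=
  [set A : {set V} | if (u \in A) && (w \notin A) then (A \in H) || (swap u w A \in H)
           else if (w \in A) && (u \notin A) then (A \in H) && (swap u w A \in H)
           else A \in H].

Lemma shift_sub u w H A : A \in shift u w H -> (A \in H) || (swap u w A \in H).
Proof. by rewrite inE; case: ifP => // _; case: ifP => [_ /andP[->]|_ ->]. Qed.

Definition one_sided u w : pred {set V} := [pred A : {set V} | (u \in A) && (w \notin A)].

Let part u w H := [set A in H | one_sided u w A].

Let cards_part u w H :
  #|H| = #|part u w H| + #|part w u H| + #|[set A : {set V} in H | (u \in A) == (w \in A)]|.
Proof.
rewrite /part -!sum1dep_card !big_mkcondr -!big_split -sum1_card /=.
by apply: eq_bigr => A _; rewrite /one_sided /=; case: (u \in A); case: (w \in A).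
Qed.

Let part_shiftl u w H : part u w (shift u w H) = part u w H :|: swap u w @: part w u H.
Proof.
apply/setP=> A; rewrite in_setU in_imset_swap !inE /one_sided /= !in_swap tpermL tpermR.
by case: (u \in A); case: (w \in A); rewrite /= ?andbF ?andbT.
Qed.

Let part_shiftr u w H :
  part w u (shift u w H) = swap u w @: (part u w H :&: swap u w @: part w u H).
Proof.
apply/setP=> A; rewrite in_imset_swap in_setI in_imset_swap !inE /one_sided /= swapK !in_swap.
rewrite tpermL tpermR.
by case: (u \in A); case: (w \in A); rewrite /= ?andbF ?andbT // andbC.
Qed.

(** With [P] the sets through [u] only and [P'] the swapped sets through [w] only, the compression
    turns these two parts into [P :|: P'] and a swapped copy of [P :&: P'], of the same total size.
    Sets containing both points or neither stay. *)
Lemma card_shift u w H : #|shift u w H| = #|H|.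
Proof.
have swi := can_inj (swapK u w).
rewrite (cards_part u w H) (cards_part u w (shift u w H)); congr (_ + _).
  rewrite part_shiftl part_shiftr (card_imset _ swi).
  by rewrite cardsUI (card_imset _ swi).
apply: eq_card => A; rewrite !inE.
by case: (u \in A); case: (w \in A); rewrite /= ?andbF.
Qed.

Definition deg w H := #|[set A : {set V} in H | w \in A]|.

Lemma deg_shift_part u w H :
  deg w (shift u w H) + #|part w u H| = deg w H + #|part w u (shift u w H)|.
Proof.
have E K : deg w K = #|part w u K| + #|[set A : {set V} in K | (u \in A) && (w \in A)]|.
  rewrite /deg /part -!sum1dep_card !big_mkcondr -!big_split /=.
  by apply: eq_bigr => A _; rewrite /one_sided /=; case: (u \in A); case: (w \in A).
have M : #|[set A : {set V} in shift u w H | (u \in A) && (w \in A)]| =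
         #|[set A : {set V} in H | (u \in A) && (w \in A)]|.
  by apply: eq_card => A; rewrite !inE; case: (u \in A); case: (w \in A); rewrite /= ?andbF.
rewrite !E M; lia.
Qed.

Let part_shift_sub u w H : part w u (shift u w H) \subset part w u H.
Proof.
apply/subsetP=> A; rewrite !inE /one_sided /= => /andP[+ /andP[wA uA]].
by rewrite wA (negbTE uA) /= => /andP[->].
Qed.

Lemma deg_shift u w H : deg w (shift u w H) <= deg w H.
Proof.
have := deg_shift_part u w H; have := subset_leq_card (part_shift_sub u w H); lia.
Qed.

(** [A] leaves the part through [w] only, and no set enters that part. This strict decrease makes
    repeated compression terminate. *)
Lemma deg_shift_lt u w H A :
  A \in H -> w \in A -> u \notin A -> swap u w A \notin H ->
  deg w (shift u w H) < deg w H.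
Proof.
move=> AH wA uA sA.
have : part w u (shift u w H) \proper part w u H.
  rewrite properE part_shift_sub; apply/subsetPn; exists A.
    by rewrite !inE /one_sided /= AH wA uA.
  by rewrite !inE /one_sided /= wA (negbTE uA) /= (negbTE sA) andbF.
move/proper_card; have := deg_shift_part u w H; lia.
Qed.

(** If some [G i] is new, it contains [u] but not [w], and its swap lies in [F i]. Swapping the
    whole matching then works: no other [G j] contains [u], so either the swap fixes it or it
    contains [w], and a set through [w] only survives compression only if its swap was present
    too. *)
Lemma rainbow_shift (I : finType) u w (J : {set I}) (F : I -> {set {set V}}) :
  rainbow J (fun i => shift u w (F i)) -> rainbow J F.
Proof.
move=> [G [GF Gdis]].
case: (boolP [forall i in J, G i \in F i]) => [/forall_inP GF'|].
  by exists G; split.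
case/forall_inPn=> i iJ GiF.
have [uGi wGi] : u \in G i /\ w \notin G i.
  have := GF i iJ; rewrite inE; case: ifP => [/andP[]//|_].
  by rewrite (negbTE GiF) if_same.
exists (fun j => swap u w (G j)); split=> [j jJ|j l jJ lJ jl]; last first.
  by apply: swap_disjoint; exact: Gdis.
have [->|ji] := eqVneq j i.
  by have := shift_sub (GF i iJ); rewrite (negbTE GiF).
have uGj : u \notin G j by rewrite (disjointFr (Gdis i j iJ jJ _)) // eq_sym.
have := GF j jJ; rewrite inE (negbTE uGj) /=.
have [wGj /andP[] //|wGj] := boolP (w \in G j).
by rewrite swap_id // (negbTE uGj) (negbTE wGj).
Qed.
End Shift.

(** * Distinct representatives and elementary counts *)

Lemma card_injection (I T : finType) (x0 : T) (J : {set I}) (S : {set T}) :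
  #|J| <= #|S| ->
  exists2 f : I -> T, {in J, forall i, f i \in S} & {in J &, injective f}.
Proof.
move=> leJS; pose f i := nth x0 (enum S) (index i (enum J)).
have idx i : i \in J -> index i (enum J) < size (enum S).
  by move=> iJ; rewrite -cardE; apply: leq_trans leJS; rewrite cardE index_mem mem_enum.
exists f => [i iJ|i j iJ jJ]; first by rewrite -mem_enum mem_nth // idx.
move/eqP; rewrite nth_uniq ?idx ?enum_uniq // => /eqP ij.
by apply: (index_inj i _ _ ij); rewrite mem_enum.
Qed.

(** The values given to the other indices are fewer than [#|S j|], so one more can always be
    chosen. *)
Lemma greedy_representatives (I T : finType) (x0 : T) (J : {set I}) (S : I -> {set T}) :
  {in J, forall i, #|J| <= #|S i|} ->
  exists2 f : I -> T, {in J, forall i, f i \in S i} & {in J &, injective f}.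
Proof.
move: {2}#|J| (erefl #|J|) => m; elim: m J => [|m IH] J cJ leJS.
  by exists (fun=> x0) => i; rewrite (cards0_eq cJ) inE.
have [j jJ] : exists j, j \in J by apply/set0Pn; rewrite -card_gt0 cJ.
have cJ' : #|J :\ j| = m by move: cJ; rewrite (cardsD1 j) jJ => -[].
have [|f fS finj] := IH _ cJ'.
  move=> i; rewrite inE => /andP[_ iJ]; rewrite cJ'; apply: leq_trans (leJS i iJ).
  by rewrite cJ.
have [x xS] : exists x, x \in S j :\: f @: (J :\ j).
  apply/set0Pn; rewrite -card_gt0 cardsD subn_gt0.
  apply: leq_ltn_trans (subset_leq_card (subsetIr _ _)) _.
  apply: leq_ltn_trans (leq_imset_card _ _) _.
  by rewrite cJ' -cJ; exact: leJS.
move: xS; rewrite inE => /andP[xf xS].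
have neq i : i \in J -> i != j -> f i != x.
  move=> iJ ij; apply: contraNneq xf => <-.
  by apply: imset_f; rewrite !inE ij.
exists (fun i => if i == j then x else f i) => [i iJ|i l iJ lJ].
  by case: eqP => [-> //|/eqP ij]; apply: fS; rewrite !inE ij.
case: eqP => [->|/eqP ij]; case: eqP => [-> //|/eqP lj].
- by move=> E; have := neq l lJ lj; rewrite E eqxx.
- by move=> E; have := neq i iJ ij; rewrite E eqxx.
- by apply: finj; rewrite !inE ?ij ?lj.
Qed.

(* The number of [r]-subsets of an [N]-set through a given point: for [r = 0]
   it is [0], whereas ['C(N.-1, r.-1)] would be [1]. *)
Definition stars N r := if r is r'.+1 then 'C(N.-1, r') else 0.

Lemma mul_stars N r : N * stars N r = r * 'C(N, r).
Proof. by case: r => [|r] /=; rewrite ?muln0 // mul_bin_diag. Qed.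

Lemma starsS N r : 0 < N -> stars N.+1 r = stars N r + stars N r.-1.
Proof.
by case: N => // N _; case: r => [|[|r]] //=; rewrite ?bin0 // binS.
Qed.

Lemma leq_card_bigcup (I T : finType) (J : {set I}) (A : I -> {set T}) :
  #|\bigcup_(i in J) A i| <= \sum_(i in J) #|A i|.
Proof.
elim/big_rec2: _ => [|i a B _ le]; first by rewrite cards0.
by rewrite cardsU; lia.
Qed.

(** * The density theorem for families of mixed uniformity *)

Section Density.
Variables V I : finType.

Definition link (v : V) (H : {set {set V}}) : {set {set V}} :=
  [set A : {set V} | (v \notin A) && (v |: A \in H)].

Lemma card_link v H : #|link v H| = deg v H.
Proof.
rewrite /deg -[LHS](card_in_imset (f := fun A : {set V} => v |: A)) => [|A B].
  apply: eq_card => A; rewrite !inE; apply/imsetP/andP => [[B]|[AH vA]].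
    by rewrite inE => /andP[vB BH] ->; rewrite BH setU11.
  by exists (A :\ v); rewrite ?inE ?eqxx setD1K.
rewrite !inE => /andP[vA _] /andP[vB _] E.
by rewrite -(setU1K vA) E setU1K.
Qed.

Lemma card_avoid1 v (H : {set {set V}}) : #|H| = #|[set A : {set V} in H | v \notin A]| + deg v H.
Proof.
rewrite /deg -sum1_card -!sum1dep_card [LHS](bigID (fun A : {set V} => v \in A)) /=.
by rewrite addnC; congr addn.
Qed.

(** [F i] has density above [(#|J| - 1) * r i / #|U|] among the [r i]-subsets of [U]. As the [r i]
    sum to [#|U|], the missing densities sum to less than [#|J| - (#|J| - 1) = 1], and the union
    bound applies. *)
Lemma rainbow_tight (J : {set I}) (U : {set V}) (r : I -> nat) (F : I -> {set {set V}}) :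
  {in J, forall i (A : {set V}), A \in F i -> (A \subset U) && (#|A| == r i)} ->
  (\sum_(i in J) r i = #|U|) ->
  {in J, forall i, #|J|.-1 * stars #|U| (r i) < #|F i|} ->
  rainbow J F.
Proof.
move=> FU rU Flt.
have [->|[j jJ]] := set_0Vmem J; first exact: rainbow0.
have le_rU i : i \in J -> r i <= #|U|.
  by move=> iJ; rewrite -rU (big_setD1 i iJ) leq_addr.
apply: (rainbow_union_bound FU); first by rewrite rU.
have J0 : 0 < #|J| by apply/card_gt0P; exists j.
have Cp i : i \in J -> (0 < 'C(#|U|, r i)%:R :> rat)%R.
  by move=> iJ; rewrite ltr0n bin_gt0 le_rU.
(* When [U] is empty one cannot divide by [#|U|]; there every [F i] consists of the empty set alone,
   so nothing is missing. *)
have [U0|U0] := posnP #|U|.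
  rewrite big1 ?ltr01 // => i iJ; apply/eqP; rewrite subr_eq0 eq_sym.
  have r0 : r i = 0 by have := le_rU i iJ; lia.
  have : 0 < #|F i| by apply: leq_ltn_trans (Flt i iJ).
  have : #|F i| <= 'C(#|U|, r i).
    rewrite -cards_draws; apply: subset_leq_card; apply/subsetP=> A /(FU i iJ).
    by rewrite inE.
  rewrite U0 r0 bin0 => h1 h2; have -> : #|F i| = 1 by lia.
  by rewrite divr1.
have Np : (0 < #|U|%:R :> rat)%R by rewrite ltr0n.
have lt i : i \in J ->
    (1 - #|F i|%:R / 'C(#|U|, r i)%:R < 1 - #|J|.-1%:R * (r i)%:R / #|U|%:R :> rat)%R.
  move=> iJ; rewrite ltrD2l ltrN2 ltr_pdivlMr ?Cp // mulrAC ltr_pdivrMr //.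
  rewrite -!natrM ltr_nat -mulnA -mul_stars mulnCA mulnC ltn_pmul2r //.
  exact: Flt.
apply: (@lt_le_trans _ _ (\sum_(i in J) (1 - #|J|.-1%:R * (r i)%:R / #|U|%:R))%R).
  rewrite !(big_setD1 j jJ) /=; apply: ltr_leD; first exact: lt.
  by apply: ler_sum => i; rewrite inE => /andP[_ iJ]; exact: ltW (lt i iJ).
rewrite sumrB sumr_const -mulr_suml -mulr_sumr -natr_sum rU mulfK ?gt_eqF //.
rewrite -natrB ?leq_pred //; case: #|J| J0 => // m _.
by rewrite subSnn.
Qed.

(** Induction on [#|U|]. If the sizes leave spare vertices, compress away from a vertex [w] until
    nothing changes, then delete [w], passing to the members avoiding it or to its link, whichever
    is dense by Pascal's rule for [stars]. In the matching found there, each link member is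
    completed by its own spare vertex, which stability allows in place of [w]. *)
Lemma rainbow_density (J : {set I}) (U : {set V}) (r : I -> nat) (F : I -> {set {set V}}) :
  {in J, forall i (A : {set V}), A \in F i -> (A \subset U) && (#|A| == r i)} ->
  (\sum_(i in J) r i <= #|U|) ->
  {in J, forall i, #|J|.-1 * stars #|U| (r i) < #|F i|} ->
  rainbow J F.
Proof.
move: {2}#|U| (erefl #|U|) => N.
elim: N U r F => [|N IHN] U r F cU.
  by move=> FU rU; apply: (rainbow_tight FU); apply/eqP; rewrite eqn_leq rU cU.
have [w wU] : exists w, w \in U by apply/set0Pn; rewrite -card_gt0 cU.
have cU' : #|U :\ w| = N by move: cU; rewrite (cardsD1 w) wU => -[].
(* Inner induction on the total degree of [w], which each compression performed below lowers. *)
move: {2}(\sum_(i in J) deg w (F i)).+1 (ltnSn (\sum_(i in J) deg w (F i))) => m.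
elim: m F => // m IHm F ltm FU rU Flt.
have [eq_rU|lt_rU] : (\sum_(i in J) r i = #|U|) \/ (\sum_(i in J) r i < #|U|).
- by move: rU; rewrite leq_eqVlt => /orP[/eqP|]; [left|right].
- exact: (rainbow_tight FU eq_rU).
case: (boolP [exists u in U, exists i in J, exists A in F i,
    [&& w \in A, u \notin A & swap u w A \notin F i]]).
  case/exists_inP=> u uU /exists_inP[i iJ] /exists_inP[A AF /and3P[wA uA sA]].
  apply: (@rainbow_shift _ _ u w); apply: IHm => //.
  - rewrite ltnS in ltm; apply: leq_trans ltm.
    rewrite !(big_setD1 i iJ) /= -addSn.
    apply: leq_add; first exact: (deg_shift_lt AF).
    by apply: leq_sum => l _; exact: deg_shift.
  - move=> l lJ B /shift_sub /orP[/(FU l lJ) //|/(FU l lJ)].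
    rewrite card_swap => /andP[sB ->]; rewrite andbT -(swapK u w B).
    exact: swap_subset.
  - by move=> l lJ; rewrite card_shift; exact: Flt.
move=> stable.
have {}stable u i A : u \in U -> i \in J -> A \in F i -> w \in A -> u \notin A ->
    swap u w A \in F i.
  move=> uU iJ AF wA uA; apply: contraNT stable => sA.
  apply/exists_inP; exists u => //; apply/exists_inP; exists i => //.
  by apply/exists_inP; exists A => //; rewrite wA uA.
pose keep i := #|J|.-1 * stars N (r i) < #|[set A : {set V} in F i | w \notin A]|.
pose F' i := if keep i then [set A : {set V} in F i | w \notin A] else link w (F i).
pose r' i := if keep i then r i else (r i).-1.
have r_gt0 i : i \in J -> ~~ keep i -> 0 < r i.
  move=> iJ; rewrite /keep; have := Flt i iJ; rewrite (card_avoid1 w).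
  case: (posnP (r i)) => // r0; rewrite r0 /= muln0 => lt.
  suff deg0 : deg w (F i) = 0 by rewrite deg0 addn0 in lt; rewrite lt.
  apply/eqP; rewrite cards_eq0; apply/eqP/setP=> A; rewrite !inE.
  apply/negbTE/negP=> /andP[AF wA]; have /andP[_] := FU i iJ A AF.
  by rewrite r0 cards_eq0 => /eqP A0; rewrite A0 inE in wA.
have sum_r' : \sum_(i in J) r i = \sum_(i in J) r' i + #|[set i in J | ~~ keep i]|.
  rewrite -sum1dep_card big_mkcondr -big_split /=; apply: eq_bigr => i iJ.
  rewrite /r'; case: ifPn => [_|k]; first by rewrite addn0.
  by rewrite /= addn1 prednK //; exact: r_gt0.
have F'U : {in J, forall i (A : {set V}), A \in F' i ->
    (A \subset U :\ w) && (#|A| == r' i)}.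
  move=> i iJ A; rewrite /F' /r'; case: ifPn => [_|k]; rewrite inE.
    case/andP=> AF wA; have /andP[AU ->] := FU i iJ A AF.
    by rewrite subsetD1 AU wA.
  case/andP=> wA AF; have /andP[AU] := FU i iJ _ AF.
  rewrite cardsU1 wA => /eqP <- /=; rewrite eqxx andbT subsetD1 wA andbT.
  by apply: subset_trans AU; exact: subsetUr.
have [||G [GF Gdis]] := IHN (U :\ w) r' F' cU' F'U.
- by rewrite cU'; lia.
- move=> i iJ; rewrite cU' /F' /r'; case: ifPn => [//|k].
  rewrite card_link; have := Flt i iJ; rewrite (card_avoid1 w) cU.
  have [N0|N0] := posnP N.
    by have := r_gt0 i iJ k; have := lt_rU; rewrite cU N0 (big_setD1 i iJ) /=; lia.
  move: k; rewrite /keep starsS // mulnDr; lia.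
have G'U i : i \in J -> (G i \subset U :\ w) && (#|G i| == r' i).
  by move=> iJ; apply: F'U => //; exact: GF.
(* Each passage to a link shortens the union by one vertex, so [T] has a vertex for every link
   member; [w] may be among them. *)
pose T := U :\: \bigcup_(i in J) G i.
have cT : #|[set i in J | ~~ keep i]| <= #|T|.
  have : #|\bigcup_(i in J) G i| <= \sum_(i in J) r' i.
    rewrite (eq_bigr (fun i => #|G i|)) => [|i /G'U/andP[_ /eqP->] //].
    exact: leq_card_bigcup.
  have := subset_leq_card (subsetIr U (\bigcup_(i in J) G i)).
  rewrite /T cardsD; lia.
have [f fT finj] := card_injection w cT.
have fG i l : i \in J -> ~~ keep i -> l \in J -> f i \notin G l.
  move=> iJ k lJ; have := fT i; rewrite inE iJ k => /(_ isT).
  rewrite inE => /andP[+ _]; apply: contra => fG.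
  by apply/bigcupP; exists l.
exists (fun i => if keep i then G i else f i |: G i); split=> [i iJ|i l iJ lJ il].
  have := GF i iJ; rewrite /F'; case: ifPn => [_|k]; rewrite inE => /andP[] //.
  move=> wG wGF; have [->//|fw] := eqVneq (f i) w.
  have fiT : f i \in T by apply: fT; rewrite inE iJ k.
  have fU : f i \in U by move: fiT; rewrite inE => /andP[].
  have := stable (f i) i (w |: G i) fU iJ wGF (setU11 _ _).
  rewrite !inE negb_or fw (fG i i) // => /(_ isT).
  suff -> : swap (f i) w (w |: G i) = f i |: G i by [].
  apply/setP=> x; rewrite in_swap !inE.
  case: tpermP => [->|->|/eqP/negbTE-> /eqP/negbTE->] //.
    by rewrite !eqxx.
  by rewrite [w == f i]eq_sym (negbTE fw) (negbTE (fG i i iJ k iJ)) (negbTE wG).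
have dG := Gdis i l iJ lJ il.
case: ifPn => ki; case: ifPn => kl //.
- by rewrite disjoint_sym disjoint_setU1 disjoint_sym dG fG.
- by rewrite disjoint_setU1 dG fG.
have fil : f i != f l.
  by apply: contraNneq il => E; apply/eqP/finj; rewrite ?inE ?iJ ?lJ.
rewrite disjoint_setU1 disjoint_sym disjoint_setU1 disjoint_sym dG.
by rewrite !inE negb_or fil !fG.
Qed.
End Density.

(** * Estimates *)

Lemma leq_bin_sub N j m : j <= N -> 'C(N, m.+1) <= 'C(N - j, m.+1) + j * 'C(N.-1, m).
Proof.
elim: j => [|j IH] jN; first by rewrite subn0 addn0.
apply: leq_trans (IH (ltnW jN)) _.
have -> : N - j = (N - j.+1).+1 by lia.
rewrite binS -addnA leq_add2l mulSn leq_add2r.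
by apply: leq_bin2l; lia.
Qed.

(** Absorption reduces this to ['C(K - Q - 1, a) <= 'C(K - 1, a)]. It serves to bound
    ['C(K, a.+1) - 'C(K - Q, a.+1)] below by [Q / K] times ['C(K, a.+1)]. *)
Lemma leq_bin_scale K Q a : Q <= K -> K * 'C(K - Q, a.+1) <= (K - Q) * 'C(K, a.+1).
Proof.
move=> QK; rewrite -(leq_pmul2l (ltn0Sn a)) mulnCA -mul_bin_diag [leqRHS]mulnCA.
rewrite -mul_bin_diag [leqRHS]mulnCA leq_mul2l leq_mul2l.
by rewrite leq_bin2l ?orbT //; lia.
Qed.

(** Factor by factor, [K * (m - i) <= m * (K - i)]. *)
Lemma leq_expn_ffact m K : m <= K -> K ^ m * m`! <= m ^ m * K ^_ m.
Proof.
move=> mK; rewrite -ffactnn !ffact_prod -[in K ^ m](card_ord m) -[in m ^ _](card_ord m).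
rewrite -!prod_nat_const -!big_split /=; apply: leq_prod => i _.
by rewrite ?card_ord !mulnBr [m * K]mulnC leq_sub2l // leq_mul2r mK orbT.
Qed.

Lemma leq_ffact_expn N m : (N ^_ m <= N ^ m)%N.
Proof.
rewrite ffact_prod -[in N ^ m](card_ord m) -prod_nat_const.
by apply: leq_prod => i _; exact: leq_subr.
Qed.

Section Numerics.
Local Open Scope ring_scope.
Variable R : realType.

(** The powers of e originate here: m^m / m! is one term of the series for e^m. *)
Lemma expn_le_expR_ffact m K : (m <= K)%N ->
  (K ^ m)%:R <= expR 1 ^+ m * (K ^_ m)%:R :> R.
Proof.
move=> mK.
have f0 : 0 < m`!%:R :> R by rewrite ltr0n fact_gt0.
have e : (m ^ m)%:R <= expR 1 ^+ m * m`!%:R :> R.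
  rewrite -ler_pdivrMr // -expRM_natl mulr1 natrX.
  case: m {mK f0} => [|m]; first by rewrite expr0 fact0 divr1 expR0.
  by apply: le_trans (@expR_ge1Dxn R _ m (ler0n _ _)); rewrite lerDr ler01.
rewrite -(ler_pM2r f0) mulrAC -natrM.
apply: (@le_trans _ _ ((m ^ m)%:R * (K ^_ m)%:R)).
  by rewrite -natrM ler_nat leq_expn_ffact.
by apply: ler_wpM2r.
Qed.

(** With [a = s - r], this compares the ways to complete an edge to a clique inside a cover of at
    most [r * K] vertices with the [a.+1]-subsets of a [K]-set. *)
Lemma bin_ratio K r a : (a < K)%N ->
  ('C(r * K, a) * K)%:R <= expR 1 ^+ a.+1 * (r ^ a * a.+1 * 'C(K, a.+1))%:R :> R.
Proof.
move=> aK.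
have f0 : 0 < a`!%:R :> R by rewrite ltr0n fact_gt0.
rewrite -(ler_pM2r f0) -natrM mulnAC bin_ffact.
apply: (@le_trans _ _ (r ^ a * K ^ a.+1)%:R).
  rewrite ler_nat expnSr mulnA leq_mul2r -expnMn; apply/orP; right.
  exact: leq_ffact_expn.
rewrite -mulrA -natrM.
have -> : (r ^ a * a.+1 * 'C(K, a.+1) * a`! = r ^ a * K ^_ a.+1)%N.
  by rewrite -bin_ffact factS; ring.
rewrite [in leLHS]natrM [in leRHS]natrM mulrCA; apply: ler_wpM2l => //; exact: expn_le_expR_ffact.
Qed.

(* [stars n.-1 r.-1] is the number of [r]-sets through two given points. *)
Lemma codegree_bound (n r K a : nat) : (0 < r)%N -> (K < n)%N -> (0 < K)%N ->
  4 * K.+1%:R * a.+2%:R * (expR 1 * r%:R) ^+ a.+2 <= n%:R :> R ->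
  3 * (r * K * a.+1)%:R * (expR 1 ^+ a.+1 * r%:R ^+ a) * (stars n.-1 r.-1)%:R
    <= 'C(n - K, r.-1)%:R :> R.
Proof.
(* For [r = 1] no edge contains two points and [stars] is 0; from here on the original [r] is
   [r.+2]. *)
case: r => // -[|r] _ Kn K0 le_n; first by rewrite mulr0 ler0n.
rewrite /= in le_n *.
case: n Kn le_n => // -[|n] Kn le_n; first by lia.
set d := 'C(n, r).
have h1 : (n.+1 * d = r.+1 * 'C(n.+1, r.+1))%N by rewrite mul_bin_diag.
have h2 : ('C(n.+1, r.+1) <= 'C(n.+2 - K, r.+1) + (K - 1) * d)%N.
  have := @leq_bin_sub n.+1 (K - 1) r ltac:(lia).
  by have -> : (n.+1 - (K - 1) = n.+2 - K)%N by lia.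
set B := 'C(n.+2 - K, r.+1) in h2 *.
(* This bounds [r.+1 * B] below by [(n.+1 - r.+1 * (K - 1)) * d]; [key] states that this coefficient
   of [d] is large enough. *)
have h3 : (n.+1 * d <= r.+1 * B + r.+1 * (K - 1) * d)%N.
  by rewrite h1; apply: leq_trans (leq_mul (leqnn r.+1) h2) _; rewrite mulnDr mulnA.
have e1 : 1 <= expR 1 :> R.
  by have := @expR_ge1Dx R 1; lra.
set P := (expR 1 * r.+2%:R) ^+ a.+1 : R.
have P1 : 1 <= P.
  apply: exprn_ege1; apply: mulr_ege1 => //; by rewrite ler1n.
have PE : expR 1 ^+ a.+1 * r.+2%:R ^+ a * r.+2%:R = P.
  by rewrite /P exprMn -mulrA -exprSr.
have key : r.+1%:R * (3 * (K * a.+1)%:R * P + (K - 1)%:R) <= n.+1%:R :> R.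
  have c : (r.+1 * K * (3 * a.+1 + 1) + 1 <= 4 * K.+1 * a.+2 * r.+2)%N by nia.
  have lower : (4 * K.+1 * a.+2 * r.+2)%:R * P <= n.+2%:R.
    apply: le_trans le_n; rewrite exprSr -/P !natrM.
    have -> : 4 * K.+1%:R * a.+2%:R * (P * (expR 1 * r.+2%:R)) =
              4 * K.+1%:R * a.+2%:R * r.+2%:R * P * expR 1 :> R by ring.
    by rewrite ler_peMr // !mulr_ge0 //; lra.
  have cP : (r.+1 * K * (3 * a.+1 + 1) + 1)%:R * P <= n.+2%:R.
    by apply: le_trans lower; rewrite ler_wpM2r ?ler_nat //; lra.
  have KP : r.+1%:R * (K - 1)%:R <= (r.+1 * K)%:R * P :> R.
    rewrite -natrM; apply: (@le_trans _ _ (r.+1 * K)%:R); last by rewrite ler_peMr.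
    by rewrite ler_nat leq_mul2l leq_subr orbT.
  have -> : n.+1%:R = n.+2%:R - 1 :> R by rewrite -[n.+2]addn1 natrD addrK.
  move: cP KP; rewrite !natrD !natrM mulr1n; set x := (K - 1)%:R; lra.
have d0 : 0 <= d%:R :> R := ler0n _ _.
have h3R : n.+1%:R * d%:R <= r.+1%:R * B%:R + r.+1%:R * (K - 1)%:R * d%:R :> R.
  by rewrite -!natrM -natrD ler_nat.
have keyd := ler_wpM2r d0 key.
rewrite -(@ler_pM2l _ r.+1%:R) ?ltr0n //.
have -> : 3 * (r.+2 * K * a.+1)%:R * (expR 1 ^+ a.+1 * r.+2%:R ^+ a) * d%:R =
          3 * (K * a.+1)%:R * P * d%:R :> R.
  by rewrite -PE !natrM; ring.
move: h3R keyd; set X := 3 * _ * P; lra.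
Qed.
(** The left side bounds the cliques built on the edges of a sparse family, the right side is the
    gain in [near_sets_gap]. After multiplication by [K] both are compared with
    [Q * 'C(K, a.+1) * 'C(n - K, r.-1)]; one of the two factors [Q] on the left is bounded by
    [K]. *)
Lemma gap_bound (n r K a Q : nat) : (0 < r)%N -> (K < n)%N -> (a < K)%N -> (Q <= K)%N ->
  4 * K.+1%:R * a.+2%:R * (expR 1 * r%:R) ^+ a.+2 <= n%:R :> R ->
  (3 * r * Q ^ 2 * stars n.-1 r.-1 * 'C(r * K, a) <=
    ('C(K, a.+1) - 'C(K - Q, a.+1)) * 'C(n - K, r.-1))%N.
Proof.
move=> r0 Kn aK QK le_n.
have K0 : (0 < K)%N by exact: leq_ltn_trans aK.
rewrite -(leq_pmul2r K0) -mulnA.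
apply: (@leq_trans (Q * 'C(K, a.+1) * 'C(n - K, r.-1))); last first.
  have := leq_bin_scale a QK; rewrite mulnBl => h.
  rewrite [leqRHS]mulnAC leq_mul2r; apply/orP; right.
  rewrite [leqRHS]mulnC mulnBr; have := leq_mul QK (leqnn 'C(K, a.+1)); lia.
rewrite -(ler_nat R).
have ratio := bin_ratio r aK; have codeg := codegree_bound r0 Kn K0 le_n.
rewrite natrM [leRHS]natrM.
apply: (@le_trans _ _ ((3 * r * Q ^ 2 * stars n.-1 r.-1)%:R *
   (expR 1 ^+ a.+1 * (r ^ a * a.+1 * 'C(K, a.+1))%:R))).
  by rewrite ler_wpM2l.
apply: (@le_trans _ _ ((Q * 'C(K, a.+1))%:R * (3 * (r * K * a.+1)%:R *
   (expR 1 ^+ a.+1 * r%:R ^+ a) * (stars n.-1 r.-1)%:R))); last by rewrite ler_wpM2l.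
have QKR : Q%:R <= K%:R :> R by rewrite ler_nat.
have -> : (3 * r * Q ^ 2 * stars n.-1 r.-1)%:R *
   (expR 1 ^+ a.+1 * (r ^ a * a.+1 * 'C(K, a.+1))%:R) =
   Q%:R * ((Q * 'C(K, a.+1))%:R * (3 * (r * a.+1)%:R *
   (expR 1 ^+ a.+1 * r%:R ^+ a) * (stars n.-1 r.-1)%:R)) :> R.
  by rewrite !natrM !natrX; ring.
have -> : (Q * 'C(K, a.+1))%:R * (3 * (r * K * a.+1)%:R *
   (expR 1 ^+ a.+1 * r%:R ^+ a) * (stars n.-1 r.-1)%:R) =
   K%:R * ((Q * 'C(K, a.+1))%:R * (3 * (r * a.+1)%:R *
   (expR 1 ^+ a.+1 * r%:R ^+ a) * (stars n.-1 r.-1)%:R)) :> R.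
  by rewrite !natrM; ring.
by rewrite ler_wpM2r // !mulr_ge0 // exprn_ge0 // expR_ge0.
Qed.
End Numerics.

(** * Degrees and cliques *)

Lemma exists_between (T : finType) (A B : {set T}) r :
  A \subset B -> #|A| <= r <= #|B| ->
  exists C : {set T}, [/\ A \subset C, C \subset B & #|C| = r].
Proof.
move=> AB /andP[Ar rB].
have : 0 < #|[set X : {set T} | X \subset B :\: A & #|X| == r - #|A|]|.
  by rewrite cards_draws bin_gt0 cardsDS //; lia.
case/card_gt0P=> X; rewrite inE subsetD => /andP[/andP[XB dXA] /eqP cX].
exists (A :|: X); split; first exact: subsetUl.
  by rewrite subUset AB XB.
rewrite cardsU setIC disjoint_setI0 // cards0 cX; lia.
Qed.

Lemma rgraph_card (V : finType) r (H : {set {set V}}) A : is_rgraph r H -> A \in H -> #|A| = r.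
Proof. by move/subsetP=> HR /HR; rewrite inE => /eqP. Qed.

Section Degrees.
Variables (V : finType) (r : nat).
Implicit Types (H : {set {set V}}) (u v : V) (T : {set V}).

Let d := stars #|V|.-1 r.-1.

(** Removing [u] and [v] injects these edges into the subsets of size [r - 2] of the other
    vertices. *)
Lemma codegree_le H u v : is_rgraph r H -> u != v ->
  #|[set A : {set V} in H | (v \in A) && (u \in A)]| <= d.
Proof.
move=> HR uv.
have inA (A : {set V}) : v \in A -> u \in A -> #|A| = (#|A :\: [set u; v]|).+2.
  move=> vA uA; rewrite -(cardsID [set u; v] A).
  have -> : A :&: [set u; v] = [set u; v].
    by apply/setIidPr/subsetP=> x; rewrite !inE => /orP[]/eqP->.
  by rewrite cards2 uv addnC addn2.
pose X := [set A : {set V} in H | (v \in A) && (u \in A)]; rewrite -/X.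
have inj : {in X &, injective (fun A : {set V} => A :\: [set u; v])}.
  move=> A B; rewrite !inE => /and3P[_ vA uA] /and3P[_ vB uB] /setP E.
  apply/setP=> x; have := E x; rewrite !inE negb_or.
  have [->|xu] := eqVneq x u; first by rewrite uA uB.
  by have [->|xv] := eqVneq x v; first by rewrite vA vB.
have [r1|r1] := leqP r 1.
  rewrite (_ : #|X| = 0) //; apply/eqP; rewrite cards_eq0; apply/eqP/setP=> A.
  rewrite !inE; apply/negbTE/negP=> /and3P[AH vA uA].
  by have := inA A vA uA; rewrite (rgraph_card HR AH); lia.
rewrite /d; case: r r1 HR => [|[|r']] //= _ HR.
rewrite -(card_in_imset inj).
have -> : #|V|.-1.-1 = #|~: [set u; v]|.
  by have := cardsC [set u; v]; rewrite cards2 uv /=; lia.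
rewrite -cards_draws; apply: subset_leq_card; apply/subsetP=> B /imsetP[A].
rewrite !inE => /and3P[AH vA uA] ->.
rewrite {1}setDE subsetIr /=.
by have := inA A vA uA; rewrite (rgraph_card HR AH) => -[] <-.
Qed.

(** An edge through [v] that meets [T] contains a second vertex from [T], and each such pair lies in
    at most [d] edges. *)
Lemma deg_hit_le H v T : is_rgraph r H -> v \notin T ->
  deg v H <= deg v [set A in H | [disjoint A & T]] + #|T| * d.
Proof.
move=> HR vT.
have sub : [set A : {set V} in H | v \in A] \subset
    [set A : {set V} in [set A in H | [disjoint A & T]] | v \in A] :|:
    \bigcup_(u in T) [set A : {set V} in H | (v \in A) && (u \in A)].
  apply/subsetP=> A; rewrite !inE => /andP[AH vA]; rewrite AH vA andbT /=.
  have [//|/pred0Pn[u /= /andP[uA uT]]] := boolP [disjoint A & T].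
  by apply/bigcupP; exists u => //; rewrite inE AH vA.
apply: leq_trans (subset_leq_card sub) _.
rewrite cardsU; apply: leq_trans (leq_subr _ _) _; rewrite leq_add2l.
apply: leq_trans (leq_card_bigcup _ _) _; rewrite -sum_nat_const; apply: leq_sum.
by move=> u uT; apply: codegree_le => //; apply: contraNneq vT => <-.
Qed.

Lemma rgraph_avoid H T : is_rgraph r H -> is_rgraph r [set A in H | [disjoint A & T]].
Proof. by apply: subset_trans; apply/subsetP=> A; rewrite inE => /andP[]. Qed.

(** One [#|J|.-1 * d] pays for the edges at [f i] through another representative; the other keeps
    the remaining links, uniform of size [r.-1] on the complement of [f @: J], above the threshold
    of [rainbow_density]. *)
Lemma rainbow_links (I : finType) (J : {set I}) (F : I -> {set {set V}}) (f : I -> V) :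
  0 < r -> #|J| * r <= #|V| ->
  {in J, forall i, is_rgraph r (F i)} ->
  {in J, forall i, 2 * #|J|.-1 * d < deg (f i) (F i)} -> {in J &, injective f} ->
  rainbow J F.
Proof.
move=> r0 JrV FR Fdeg finj.
have [->|[i0 i0J]] := set_0Vmem J; first exact: rainbow0.
have J0 : 0 < #|J| by apply/card_gt0P; exists i0.
pose W := f @: J.
have cW : #|W| = #|J| by rewrite card_in_imset.
have cU : #|~: W| = #|V| - #|J| by rewrite cardsCs setCK cW.
pose L i := link (f i) [set A in F i | [disjoint A & W :\ f i]].
have LU : {in J, forall i (A : {set V}), A \in L i -> (A \subset ~: W) && (#|A| == r.-1)}.
  move=> i iJ A; rewrite !inE => /and3P[fA AF].
  rewrite disjoint_setU1 => /andP[_ dA].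
  have := rgraph_card (FR i iJ) AF; rewrite cardsU1 fA => <- /=; rewrite eqxx andbT.
  rewrite -disjoints_subset -(setD1K (imset_f f iJ : f i \in W)) disjoint_sym disjoint_setU1 fA.
  by rewrite disjoint_sym.
have [||G [GL Gdis]] := rainbow_density LU.
- rewrite sum_nat_const cU; move: JrV; case: r r0 => // r' _; rewrite mulnS /=; lia.
- move=> i iJ; rewrite card_link.
  have := deg_hit_le (FR i iJ) (negbT (setD11 (f i) W)).
  have -> : #|W :\ f i| = #|J|.-1.
    by rewrite -cW (cardsD1 (f i) W) imset_f.
  have le : #|J|.-1 * stars #|~: W| r.-1 <= #|J|.-1 * d.
    rewrite leq_mul2l /d cU; apply/orP; right; rewrite /stars; case: r.-1 => // r'.
    by apply: leq_bin2l; lia.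
  have := Fdeg i iJ; lia.
exists (fun i => f i |: G i); split=> [i iJ|i l iJ lJ il].
  by have := GL i iJ; rewrite !inE => /and3P[].
have nG x y : x \in J -> y \in J -> f x \notin G y.
  move=> xJ yJ; have /andP[/subsetP sG _] := LU y yJ _ (GL y yJ).
  by apply/negP => /sG; rewrite inE imset_f.
have fil : f i != f l by apply: contraNneq il => E; apply/eqP/finj.
rewrite disjoint_setU1 disjoint_sym disjoint_setU1 disjoint_sym (Gdis _ _ iJ lJ il).
by rewrite !inE negb_or fil !nG.
Qed.
End Degrees.

(** * Counting cliques near a vertex set *)

Section CountCliques.
Variable V : finType.
Implicit Types (W Z Y S : {set V}) (H : {set {set V}}).

(* The [s]-cliques of the [r]-graph of all [r]-sets meeting [W], when [r <= s]. *)
Definition near_sets r s W := [set S : {set V} | (#|S| == s) && (#|S :\: W| < r)].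

(** Let a clique [S] have at least [r] vertices outside [Z]. Fewer than [r] lie outside [Z :|: Y],
    or an edge among them would miss both sets; so some edge [A] lies between [S :\: (Z :|: Y)] and
    [S :\: Z], and the rest of [S] is in [Z :|: Y]. *)
Lemma num_cliques_le r s H Z Y : r <= s -> is_rgraph r H ->
  (forall A, A \in H -> [disjoint A & Z] -> ~~ [disjoint A & Y]) ->
  num_cliques r s H <=
    #|near_sets r s Z| + #|[set A in H | [disjoint A & Z]]| * 'C(#|Z :|: Y|, s - r).
Proof.
move=> rs HR cover.
pose X := [set B : {set V} | B \subset Z :|: Y & #|B| == s - r].
have sub : [set S : {set V} | is_clique r s H S] \subset near_sets r s Z :|:
    (fun p => p.1 :|: p.2) @: setX [set A in H | [disjoint A & Z]] X.
  apply/subsetP=> S; rewrite !inE => /andP[/eqP cS /forall_inP clS].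
  have {}clS (A : {set V}) : A \subset S -> #|A| = r -> A \in H.
    by move=> AS cA; have := clS A; rewrite inE cA eqxx AS; apply.
  rewrite cS eqxx /=; have [//|SZ] := ltnP #|S :\: Z| r.
  have SZY : #|S :\: (Z :|: Y)| < r.
    rewrite ltnNge; apply/negP=> le.
    have [A [_ AS cA]] := exists_between (sub0set (S :\: (Z :|: Y)))
      (r := r) ltac:(by rewrite cards0 le).
    move: AS; rewrite subsetD disjoint_sym => /andP[AS].
    rewrite disjoints_subset subUset -!disjoints_subset ![[disjoint _ & A]]disjoint_sym.
    case/andP=> dZ dY.
    by have := cover A (clS A AS cA) dZ; rewrite dY.
  have [A [ZYA AS cA]] := exists_between (setDS S (subsetUl Z Y)) (r := r)
    ltac:(by rewrite SZ ltnW).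
  move: AS; rewrite subsetD => /andP[AS dA].
  apply/imsetP; exists (A, S :\: A); last first.
    by rewrite /= setDE setUIr setUCr setIT; apply/esym/setUidPr.
  rewrite !inE clS // dA /= cardsDS // cS cA eqxx andbT.
  apply/subsetP=> x; rewrite inE => /andP[xA xS]; apply: contraR xA => xZY.
  by apply: (subsetP ZYA); rewrite inE xZY.
apply: leq_trans (subset_leq_card sub) _; rewrite cardsU.
apply: leq_trans (leq_subr _ _) _; rewrite leq_add2l.
by apply: leq_trans (leq_imset_card _ _) _; rewrite cardsX cards_draws.
Qed.

Lemma card_split W (P Q : {set {set V}}) :
  {in P, forall A : {set V}, A \subset W} -> {in Q, forall B : {set V}, B \subset ~: W} ->
  #|[set S : {set V} | (S :&: W \in P) && (S :\: W \in Q)]| = #|P| * #|Q|.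
Proof.
move=> PW QW; rewrite -cardsX.
have restr (A B : {set V}) : A \subset W -> B \subset ~: W ->
    ((A :|: B) :&: W = A) /\ ((A :|: B) :\: W = B).
  move=> /subsetP AW /subsetP BW; split; apply/setP=> x; rewrite !inE.
    have := AW x; have := BW x; rewrite inE.
    by case: (x \in A); case: (x \in B); case: (x \in W) => //= h1 h2;
       move: (h1 isT) || move: (h2 isT).
  have := AW x; have := BW x; rewrite inE.
  by case: (x \in A); case: (x \in B); case: (x \in W) => //= h1 h2;
     move: (h1 isT) || move: (h2 isT).
rewrite -(card_in_imset (f := fun p : {set V} * {set V} => p.1 :|: p.2)).
  apply: eq_card => S; rewrite inE; apply/andP/imsetP => [[SP SQ]|[[A B]]].
    by exists (S :&: W, S :\: W); rewrite ?inE ?SP ?SQ //= setID.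
  rewrite inE /= => /andP[AP BQ] ->.
  by have [-> ->] := restr A B (PW A AP) (QW B BQ).
move=> [A B] [A' B']; rewrite !inE /= => /andP[AP BQ] /andP[AP' BQ'] E.
have [E1 E2] := restr A B (PW A AP) (QW B BQ).
have [E3 E4] := restr A' B' (PW A' AP') (QW B' BQ').
by congr pair; [rewrite -E1 E E3 | rewrite -E2 E E4].
Qed.

(** Sort by the number [j] of vertices outside [W]. Only the sizes of [V] and [W] enter, so the
    count carries over from ['I_n] to [V]. *)
Lemma card_near_sets r s W : r <= s.+1 ->
  #|near_sets r s W| = \sum_(j < r) 'C(#|W|, s - j) * 'C(#|V| - #|W|, j).
Proof.
elim: r => [|r IH] rs.
  rewrite big_ord0; apply/eqP; rewrite cards_eq0; apply/eqP/setP=> S.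
  by rewrite !inE ltn0 andbF.
rewrite big_ord_recr /= -IH; last exact: ltnW.
rewrite -[#|V| - _](_ : #|~: W| = _); last by rewrite cardsCs setCK.
rewrite -!cards_draws -(card_split (W := W)); last 2 first.
- by move=> A; rewrite inE => /andP[].
- by move=> A; rewrite inE => /andP[].
set X := near_sets r s W; set Y := [set S | _].
rewrite -(cardsUI X Y) (_ : X :&: Y = set0) ?cards0 ?addn0.
  apply: eq_card => S; rewrite !inE subsetIr setDE subsetIr /= -setDE ltnS.
  have := cardsID W S; lia.
apply/setP=> S; rewrite !inE subsetIr setDE subsetIr /= -setDE; lia.
Qed.

(** Take [s - r + 1] vertices in [W], not all in [Z], and [r - 1] outside [W]. Such a set has fewer
    than [r] vertices outside [W] but at least [r] outside [Z]. *)
Lemma near_sets_gap r s W Z : 0 < r <= s -> Z \subset W ->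
  #|near_sets r s Z| +
    ('C(#|W|, (s - r).+1) - 'C(#|Z|, (s - r).+1)) * 'C(#|V| - #|W|, r.-1)
  <= #|near_sets r s W|.
Proof.
case/andP=> r0 rs ZW.
pose P := [set A : {set V} | A \subset W & #|A| == (s - r).+1] :\:
          [set A : {set V} | A \subset Z & #|A| == (s - r).+1].
pose Q := [set B : {set V} | B \subset ~: W & #|B| == r.-1].
have cP : #|P| = 'C(#|W|, (s - r).+1) - 'C(#|Z|, (s - r).+1).
  rewrite /P cardsDS ?cards_draws //; apply/subsetP=> A; rewrite !inE.
  by case/andP=> AZ ->; rewrite (subset_trans AZ ZW).
have cQ : #|Q| = 'C(#|V| - #|W|, r.-1).
  by rewrite cards_draws cardsCs setCK.
rewrite -cP -cQ -(card_split (W := W)); last 2 first.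
- by move=> A; rewrite !inE => /and3P[].
- by move=> A; rewrite inE => /andP[].
set X := near_sets r s Z; set Y := [set S | _].
rewrite -(cardsUI X Y) (_ : X :&: Y = set0) ?cards0 ?addn0.
  apply: subset_leq_card; apply/subsetP=> S; rewrite !inE subsetIr.
  have := cardsID W S; have := subset_leq_card (setDS S ZW).
  case: (_ \subset _) => /=; case: (_ \subset _) => /=; lia.
apply/setP=> S; rewrite !inE subsetIr /=; apply/negbTE/negP.
case/andP=> /andP[/eqP cS SZ] /andP[/andP[SWZ /eqP cSW] /andP[_ /eqP cSD]].
move: SWZ; rewrite cSW eqxx andbT => /subsetPn[x]; rewrite inE => /andP[xS xW xZ].
have : x |: (S :\: W) \subset S :\: Z.
  by rewrite subUset sub1set inE xZ xS setDS.
move/subset_leq_card; rewrite cardsU1 inE xW /= cSD; lia.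
Qed.
End CountCliques.

Lemma num_cliques_Fnk1 r s n K : r <= s ->
  num_cliques r s (Fnk1 r n K) = #|near_sets r s [set i : 'I_n | i < K]|.
Proof.
move=> rs; apply: eq_card => S; rewrite !inE /is_clique; congr (_ && _).
set W := [set i : 'I_n | i < K].
apply/forall_inP/idP => [clS|lt A].
  rewrite ltnNge; apply/negP=> le.
  have [A [_ AS cA]] := exists_between (sub0set (S :\: W)) (r := r)
    ltac:(by rewrite cards0 le).
  move: AS; rewrite subsetD => /andP[AS dA].
  have := clS A; rewrite !inE cA eqxx AS /= => /(_ isT).
  by rewrite disjoint_setI0 ?eqxx.
rewrite !inE => /eqP cA; apply/implyP=> AS; rewrite cA eqxx /=.
apply: contraTneq lt => AW; rewrite -leqNgt -cA; apply: subset_leq_card.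
by rewrite subsetD AS -setI_eq0 AW eqxx.
Qed.

Lemma card_ord_lt n K : K <= n -> #|[set i : 'I_n | i < K]| = K.
Proof.
have inj (Kn : K <= n) : injective (widen_ord Kn) by move=> x y [] /val_inj.
move=> Kn; rewrite -[RHS](card_ord K) -(card_imset _ (inj Kn)).
apply: eq_card => i; rewrite inE; apply/idP/imsetP => [iK|[j _ ->]]; last exact: (ltn_ord j).
by exists (Ordinal iK) => //; apply: val_inj.
Qed.

(** * Induction on the number of families *)

Section Induction.
Variables (V I : finType) (r k : nat) (F : I -> {set {set V}}).
Hypotheses (r_gt0 : 0 < r) (krV : k * r <= #|V|) (FR : forall i, is_rgraph r (F i)).
Let d := stars #|V|.-1 r.-1.

(** The threshold is the degree that [rainbow_links] requires for [Q.+1] families. *)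
Definition heavy (Z : {set V}) (Q : nat) i :=
  [set v | 2 * Q * d < deg v (avoid Z F i)].

(** The obstruction left by a failed induction step with [Q] other families: [Y] will be the union
    of a rainbow matching of theirs. *)
Definition sparse_cover (Z : {set V}) (Q : nat) i := exists Y : {set V},
  [/\ #|Y| <= r * Q, #|avoid Z F i| <= 3 * r * Q ^ 2 * d &
      forall A, A \in F i -> [disjoint A & Z] -> ~~ [disjoint A & Y]].

Lemma avoidR Z i : is_rgraph r (avoid Z F i).
Proof. exact: rgraph_avoid. Qed.

Lemma avoidU Y Z i : avoid Y (avoid Z F) i = avoid (Y :|: Z) F i.
Proof.
apply/setP=> A; rewrite !inE -andbA; congr (_ && _).
by rewrite ![[disjoint A & _]]disjoint_sym !disjoints_subset subUset andbC.
Qed.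

Lemma card_rainbow_union (J : {set I}) (H : I -> {set {set V}}) (G : I -> {set V}) :
  {in J, forall i, is_rgraph r (H i)} -> {in J, forall i, G i \in H i} ->
  #|\bigcup_(i in J) G i| <= r * #|J|.
Proof.
move=> HR GH; apply: leq_trans (leq_card_bigcup _ _) _.
rewrite mulnC -sum_nat_const; apply: leq_sum => i iJ.
by rewrite (rgraph_card (HR i iJ) (GH i iJ)).
Qed.

Lemma rainbow_extend_disjoint (J : {set I}) (H : I -> {set {set V}}) (G : I -> {set V}) i A :
  i \in J -> A \in H i -> [disjoint A & \bigcup_(j in J :\ i) G j] ->
  {in J :\ i, forall j, G j \in H j} ->
  {in J :\ i &, forall j l, j != l -> [disjoint G j & G l]} -> rainbow J H.
Proof.
move=> iJ AH dA GH Gdis; apply: (rainbow_extend iJ AH).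
exists G; split=> // j jJ; rewrite inE GH //= disjoint_sym.
by apply: disjointWr dA; exact: bigcup_sup.
Qed.

Lemma rainbow_induction (J : {set I}) (Z : {set V}) : #|J| + #|Z| <= k ->
  (forall (i : I) (Z' : {set V}) Q, Q + #|Z'| < k -> ~ sparse_cover Z' Q i) ->
  rainbow J (avoid Z F).
Proof.
move=> JZ nosparse; move: {2}#|J|.+1 (ltnSn #|J|) => m.
elim: m J Z JZ => // m IH J Z JZ Jm.
have cJ i : i \in J -> #|J| = #|J :\ i|.+1 by move=> iJ; rewrite (cardsD1 i) iJ.
have [->|[i0 i0J]] := set_0Vmem J; first exact: rainbow0.
case: (boolP [exists i in J, exists v, r * #|J|.-1 * d < deg v (avoid Z F i)]).
  case/exists_inP=> i iJ /existsP[v vdeg]; have Ji := cJ i iJ.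
  have [||G [GF Gdis]] := IH (J :\ i) (v |: Z).
  - by rewrite cardsU1; case: (v \notin Z); lia.
  - lia.
  have GH : {in J :\ i, forall j, G j \in avoid Z F j}.
    move=> j jJ; have := GF j jJ; rewrite -avoidU inE => /andP[]; by [].
  pose T := \bigcup_(j in J :\ i) G j.
  have vT : v \notin T.
    apply/bigcupP=> -[j jJ vG]; have := GF j jJ; rewrite inE => /andP[_].
    by move/disjointFr => /(_ v vG); rewrite setU11.
  have cT : #|T| <= r * #|J|.-1.
    rewrite Ji; apply: (card_rainbow_union (H := avoid Z F)) => // j _; exact: avoidR.
  (* At most [#|T| * d] of the edges at [v] meet the matching, so one is left for [i]. *)
  have := deg_hit_le (avoidR Z i) vT; rewrite -/d => le.
  have : 0 < deg v [set A in avoid Z F i | [disjoint A & T]].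
    have : #|T| * d <= r * #|J|.-1 * d by rewrite leq_mul2r cT orbT.
    by move: vdeg le; lia.
  case/card_gt0P=> A; rewrite inE => /andP[]; rewrite inE => /andP[AF AT] _.
  exact: (rainbow_extend_disjoint iJ AF AT GH Gdis).
move=> nohuge.
case: (boolP [forall i in J, #|J| <= #|heavy Z #|J|.-1 i|]).
  move/forall_inP=> heavyJ.
  have [x0 _] : exists x, x \in heavy Z #|J|.-1 i0.
    by apply/card_gt0P; apply: leq_trans (heavyJ _ i0J); apply/card_gt0P; exists i0.
  have [f fheavy finj] := greedy_representatives x0 heavyJ.
  apply: (rainbow_links (f := f) r_gt0) => //.
  - by apply: leq_trans krV; rewrite leq_mul2r; apply/orP; right; lia.
  - by move=> i _; exact: avoidR.
  - by move=> i iJ; have := fheavy i iJ; rewrite inE.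
case/forall_inPn=> i iJ; rewrite -ltnNge => few; have Ji := cJ i iJ.
have [||G [GF Gdis]] := IH (J :\ i) Z; [by lia|by lia|].
pose T := \bigcup_(j in J :\ i) G j.
have cT : #|T| <= r * #|J|.-1.
  rewrite Ji; apply: (card_rainbow_union (H := avoid Z F)) => // j _; exact: avoidR.
case: (boolP [exists A in avoid Z F i, [disjoint A & T]]).
  by case/exists_inP=> A AF AT; exact: (rainbow_extend_disjoint iJ AF AT GF Gdis).
move=> cover; exfalso; apply: (nosparse i Z #|J|.-1); first by lia.
have {}cover A : A \in avoid Z F i -> ~~ [disjoint A & T].
  by move=> AF; apply: contra cover => AT; apply/exists_inP; exists A.
exists T; split=> // [|A AF AZ]; last by apply: cover; rewrite inE AF.
have sub : avoid Z F i \subset \bigcup_(v in T) [set A : {set V} in avoid Z F i | v \in A].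
  apply/subsetP=> A AF; have /pred0Pn[v /= /andP[vA vT]] := cover A AF.
  by apply/bigcupP; exists v; rewrite // inE AF.
apply: leq_trans (subset_leq_card sub) _.
apply: leq_trans (leq_card_bigcup _ _) _.
set Q := #|J|.-1 in nohuge few cT *.
(* A vertex of [T] lies in at most [2 * Q * d] edges unless heavy, and then in at most [r * Q * d],
   by [nohuge]. With at most [r * Q] vertices, at most [Q] of them heavy, this gives the constant
   [3 = 2 + 1]. *)
apply: (@leq_trans (\sum_(v in T) (2 * Q * d + (v \in heavy Z Q i) * (r * Q * d)))).
  apply: leq_sum => v _; rewrite inE -/(deg v (avoid Z F i)).
  have [hv|hv] := ltnP; last by apply: leq_trans hv _; exact: leq_addr.
  rewrite mul1n; apply: leq_trans (leq_addl _ _).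
  rewrite leqNgt; apply: contra nohuge => hd.
  by apply/exists_inP; exists i => //; apply/existsP; exists v.
rewrite big_split /= sum_nat_const -big_distrl /= -big_mkcondr sum1_card.
have QJ : #|J| = Q.+1 by rewrite /Q Ji.
have few' : #|[pred v in T | v \in heavy Z Q i]| <= Q.
  apply: leq_trans (_ : #|heavy Z Q i| <= Q); last by rewrite -ltnS -QJ.
  by apply: subset_leq_card; apply/subsetP=> v /andP[].
have h1 := leq_mul cT (leqnn (2 * Q * d)); have h2 := leq_mul few' (leqnn (r * Q * d)).
apply: leq_trans (leq_add h1 h2) _; apply: eq_leq; rewrite expnS expn1; ring.
Qed.
End Induction.

(** * Consequences of the bound on the order, and the conclusion *)

Section LargeOrder.
Local Open Scope ring_scope.

Lemma parameters_large (R : realType) (n k r t : nat) : (0 < r)%N -> (r <= t)%N ->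
  4 * k%:R * (t - r + 2)%N%:R * (expR 1 * r%:R) ^+ (t - r + 2)%N <= n%:R :> R ->
  (k * r <= n)%N.
Proof.
move=> r0 rt le_n; rewrite -(ler_nat R); apply: le_trans le_n.
have e1 : 1 <= expR 1 :> R by have := @expR_ge1Dx R 1; lra.
have r1 : 1 <= r%:R :> R by rewrite ler1n.
have er1 : 1 <= expR 1 * r%:R :> R by rewrite mulr_ege1.
rewrite natrM; have -> : (t - r + 2)%N = (t - r).+2 by lia.
apply: (@le_trans _ _ (k%:R * (expR 1 * r%:R))).
  by rewrite ler_wpM2l // ler_peMl.
apply: ler_pM => //; first by lra.
- have : 1 <= (t - r).+2%:R :> R by rewrite ler1n.
  have := ler0n R k; nra.
- by rewrite exprS ler_peMr ?exprn_ege1 //; lra.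
Qed.

Lemma parameters_mono (R : realType) (n k r s t : nat) : (0 < r)%N -> (r <= s <= t)%N ->
  4 * k%:R * (t - r + 2)%N%:R * (expR 1 * r%:R) ^+ (t - r + 2)%N <= n%:R :> R ->
  4 * k%:R * (s - r).+2%:R * (expR 1 * r%:R) ^+ (s - r).+2 <= n%:R :> R.
Proof.
move=> r0 /andP[rs st]; apply: le_trans.
have e1 : 1 <= expR 1 :> R by have := @expR_ge1Dx R 1; lra.
have er1 : 1 <= expR 1 * r%:R :> R by rewrite mulr_ege1 // ler1n.
have k0 : 0 <= 4 * k%:R :> R by rewrite mulr_ge0.
apply: ler_pM.
- by rewrite mulr_ge0.
- by rewrite exprn_ge0 //; lra.
- by rewrite ler_wpM2l // ler_nat; lia.
- by rewrite ler_weXn2l //; lia.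
Qed.
End LargeOrder.

(** Extend [Z] to a set [W] of size [k - 1]. Then [near_sets r s W] is as large as the extremal
    clique count, and it exceeds [near_sets r s Z] by at least what the sparse edges can contribute,
    so [F i] would have too few cliques. *)
Lemma not_sparse_cover (R : realType) (V I : finType) (k r s Q : nat)
    (F : I -> {set {set V}}) (i : I) (Z : {set V}) :
  0 < r <= s -> s - r < k.-1 -> k.-1 < #|V| -> Q + #|Z| < k -> is_rgraph r (F i) ->
  (4 * k%:R * (s - r).+2%:R * (expR 1 * r%:R) ^+ (s - r).+2 <= #|V|%:R :> R)%R ->
  num_cliques r s (Fnk1 r #|V| (k - 1)) < num_cliques r s (F i) ->
  ~ sparse_cover r F Z Q i.
Proof.
move=> /andP[r0 rs] ak kV QZ FR le_n cliq [Y [cY cF cover]].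
have Kk : (k.-1).+1 = k by lia.
set K := k.-1 in ak kV Kk *.
have cliqF := num_cliques_le rs FR cover.
have [W [ZW _ cW]] := exists_between (subsetT Z) (r := K) ltac:(rewrite cardsT; lia).
have gapW := near_sets_gap (r := r) (s := s) ltac:(by rewrite r0 rs) ZW.
have cliqW : num_cliques r s (Fnk1 r #|V| (k - 1)) = #|near_sets r s W|.
  rewrite num_cliques_Fnk1 // !card_near_sets; try lia.
  by rewrite card_ord_lt ?card_ord ?cW ?subn1 //; lia.
rewrite -Kk in le_n.
have gap := gap_bound r0 kV ak (_ : Q <= K) le_n.
have {}gap := gap ltac:(lia).
(* [#|Z :|: Y| <= (K - Q) + r * Q <= r * K], since [Q <= K]. *)
have le1 : 'C(#|Z :|: Y|, s - r) <= 'C(r * K, s - r).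
  by apply: leq_bin2l; rewrite cardsU; nia.
have le2 : 'C(#|Z|, (s - r).+1) <= 'C(K - Q, (s - r).+1) by apply: leq_bin2l; lia.
have le3 : ('C(K, (s - r).+1) - 'C(K - Q, (s - r).+1)) * 'C(#|V| - K, r.-1) <=
           ('C(K, (s - r).+1) - 'C(#|Z|, (s - r).+1)) * 'C(#|V| - K, r.-1).
  by rewrite leq_mul2r leq_sub2l ?orbT.
have le4 := leq_mul cF le1.
rewrite cW in gapW.
have := leq_trans cliqF (leq_add (leqnn _) (leq_trans le4 (leq_trans gap le3))).
by move/leq_trans => /(_ _ gapW); rewrite -cliqW leqNgt cliq.
Qed.

Theorem theorem1p6 (R : realType) (n k r t : nat)
  (n_gt0 : 0 < n) (k_gt0 : 0 < k) (r_gt0 : 0 < r) (t_gt0 : 0 < t)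
  (le_rt : r <= t) (le_tkr : t <= k + r - 2)
  (le_n : (4 * k%:R * (t - r + 2)%N%:R * (expR 1 * r%:R) ^+ (t - r + 2)%N
             <= n%:R :> R)%R)
  (V : finType) (cardV : #|V| = n)
  (F : 'I_k -> {set {set V}}) (F_rgraph : forall i : 'I_k, is_rgraph r (F i))
  (F_cliques : forall i : 'I_k, exists s : nat,
     r <= s <= t /\ num_cliques r s (Fnk1 r n (k - 1)) < num_cliques r s (F i)) :
  exists G : 'I_k -> {set V},
    (forall i : 'I_k, G i \in F i) /\
    (forall i j : 'I_k, i != j -> [disjoint G i & G j]).
Proof.
have krn := parameters_large r_gt0 le_rt le_n.
subst n.
have [|i Z Q QZ|G [GF Gdis]] :=
  @rainbow_induction V 'I_k r k F r_gt0 krn F_rgraph setT set0.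
- by rewrite cardsT card_ord cards0 addn0.
- have [s [/andP[rs st] cliq]] := F_cliques i.
  apply: (not_sparse_cover (R := R) (s := s) _ _ _ QZ (F_rgraph i) _ cliq).
  + by rewrite r_gt0.
  (* From [r <= t <= k + r - 2] one gets [k >= 2], hence [s - r <= k - 2]. *)
  + by lia.
  + by move: krn r_gt0 k_gt0; case: (r) => // r' krn _ k0; nia.
  + by apply: parameters_mono le_n; rewrite ?rs.
exists G; split=> [i|i j]; last exact: Gdis.
by have := GF i (in_setT i); rewrite inE => /andP[].
Qed.
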